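(* Let $r\ge2$ and $s\ge2$ be integers, and let $H$ be an $r$-uniform hypergraph with $s(H)=s$. Then for all $n\ge|V(H)|$, \[\mathrm{wsat}(n,H)\ge\gamma_{s,H}\left(\binom{n}{s-1}-|\partial_{s-1}(H)|\right)+|E(H)|-1.\]
   Context: An $r$-uniform hypergraph $H$ has finite vertex set $V(H)$ and edge set $E(H)\subseteq\binom{V(H)}{r}$. $K_n^r$ is the complete $r$-uniform hypergraph on $n$ vertices. For non-empty $H$, $F$ on $n$ vertices is weakly $H$-saturated if the edges of $E(K_n^r)\setminus E(F)$ can be ordered $e_1,\dots,e_k$ so that each $F\cup\{e_1,\dots,e_i\}$ contains a copy of $H$ containing $e_i$; $\mathrm{wsat}(n,H)$ is the minimum number of edges of such $F$. The sparseness $s(H)$ of non-empty $H$ is the size of a smallest $S\subseteq V(H)$ contained in exactly one edge of $H$. For $m\ge1$, the $m$-shadow $\partial_m(G)$ is the set of $m$-element sets contained in some edge of $G$. Define \[\gamma_{s,H}=\min\left\{\frac{|E(H)|-|E(G)|-1}{|\partial_{s-1}(H)|-|\partial_{s-1}(G)|}: G\subseteq H,\ E(G)\neq\emptyset,\ |\partial_{s-1}(G)|<|\partial_{s-1}(H)|\right\},\] where $G\subseteq H$ means $E(G)\subseteq E(H)$. *)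

(* Defs.v *)
From mathcomp Require Import all_boot all_order all_algebra.
From mathcomp Require Import zify.

Set Implicit Arguments.
Unset Strict Implicit.
Unset Printing Implicit Defensive.

Import Order.TTheory GRing.Theory Num.Theory.

(* A hypergraph with vertex set V is its edge set H : {set {set V}}; vertices
   in no edge are allowed, and |V(H)| is #|V|. *)
Definition uniform (V : finType) (r : nat) (H : {set {set V}}) : bool :=
  [forall e in H, #|e| == r].

Definition complete (V : finType) (r : nat) : {set {set V}} :=
  [set e : {set V} | #|e| == r].

Definition shadow (V : finType) (m : nat) (G : {set {set V}}) : {set {set V}} :=
  [set S : {set V} | (#|S| == m) && [exists e in G, S \subset e]].

Definition in_one_edge (V : finType) (H : {set {set V}}) (S : {set V}) : bool :=
  #|[set e in H | S \subset e]| == 1.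

(* The default #|V| bounds every #|S|, so this is the true minimum as soon as
   the range is non-empty, i.e. for uniform H != set0 (see sparsenessP). *)
Definition sparseness (V : finType) (H : {set {set V}}) : nat :=
  \big[minn/#|V|]_(S : {set V} | in_one_edge H S) #|S|.

Definition copy (V W : finType) (f : {ffun V -> W}) (H : {set {set V}}) :
    {set {set W}} :=
  [set f @: (e : {set V}) | e in H].

Definition has_copy_with (V W : finType) (H : {set {set V}})
    (F : {set {set W}}) (e : {set W}) : bool :=
  [exists f : {ffun V -> W},
     [&& injectiveb f, copy f H \subset F & e \in copy f H]].

(* es orders the missing edges; take i.+1 es are its first i+1 entries, the
   last of which is tnth es i. *)
Definition weakly_saturated (V : finType) (r n : nat) (H : {set {set V}})
    (F : {set {set 'I_n}}) : bool :=
  (F \subset complete 'I_n r) &&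
  [exists es : #|complete 'I_n r :\: F|.-tuple {set 'I_n},
     perm_eq es (enum (complete 'I_n r :\: F)) &&
     [forall i : 'I_#|complete 'I_n r :\: F|,
        has_copy_with H (F :|: [set e in take i.+1 es]) (tnth es i)]].

(* The default 'C(n, r) is the size of the complete hypergraph, which is weakly
   saturated, so this is the true minimum (see wsatP). *)
Definition wsat (V : finType) (r n : nat) (H : {set {set V}}) : nat :=
  \big[minn/'C(n, r)]_(F : {set {set 'I_n}} | weakly_saturated r H F) #|F|.

Local Open Scope ring_scope.

Definition gamma_range (V : finType) (s : nat) (H G : {set {set V}}) : bool :=
  [&& G \subset H, G != set0 &
      (#|shadow (s - 1)%N G| < #|shadow (s - 1)%N H|)%N].

Definition gamma_ratio (V : finType) (s : nat) (H G : {set {set V}}) : rat :=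
  (#|H|%:R - #|G|%:R - 1) /
  (#|shadow (s - 1)%N H|%:R - #|shadow (s - 1)%N G|%:R).

(* Every ratio in range is at most #|H|, so the default does not affect the
   minimum when the range is non-empty, as it is when sparseness H >= 2
   (see gammaP and gamma_range_ex). *)
Definition gamma (V : finType) (s : nat) (H : {set {set V}}) : rat :=
  \big[Num.min/#|H|%:R]_(G : {set {set V}} | gamma_range s H G)
    gamma_ratio s H G.

Local Close Scope ring_scope.

Lemma bigminn_attained (I : finType) (x : nat) (P : pred I) (F : I -> nat)
    (j : I) : P j -> (forall i, P i -> F i <= x) ->
  (exists2 i, P i & \big[minn/x]_(i | P i) F i = F i) /\
  (forall i, P i -> \big[minn/x]_(i | P i) F i <= F i).
Proof.
move=> Pj le_x.
have -> : \big[minn/x]_(i | P i) F i = \big[Order.min/x]_(i | P i) F i.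
  by apply: (big_rec2 (fun a b => a = b)) => // i a b _ ->; rewrite minEnat.
split; last by move=> i Pi; rewrite -leEnat; apply: bigmin_le_cond.
have [|i Pi ->] := eq_bigmin (T := nat) (x := x) j P F Pj; last by exists i.
by move=> i Pi; rewrite leEnat le_x.
Qed.

Lemma in_one_edge_edge (V : finType) (r : nat) (H : {set {set V}}) (e : {set V}) :
  uniform r H -> e \in H -> in_one_edge H e.
Proof.
move=> /forall_inP Hr eH; apply/cards1P; exists e; apply/setP=> f.
rewrite !inE; apply/andP/eqP => [[fH sef]|->]; last by rewrite eH subxx.
by apply/esym/eqP; rewrite eqEcard sef (eqP (Hr _ eH)) (eqP (Hr _ fH)) /=.
Qed.

Lemma sparsenessP (V : finType) (r : nat) (H : {set {set V}}) :
  uniform r H -> H != set0 ->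
  (exists2 S, in_one_edge H S & sparseness H = #|S|) /\
  (forall S, in_one_edge H S -> sparseness H <= #|S|).
Proof.
move=> Hr /set0Pn[e eH].
apply: (bigminn_attained (in_one_edge_edge Hr eH)) => S _; exact: max_card.
Qed.

Lemma weakly_saturated_complete (V : finType) (r n : nat) (H : {set {set V}}) :
  weakly_saturated r H (complete 'I_n r).
Proof.
rewrite /weakly_saturated subxx /=.
have szK : size (enum (complete 'I_n r :\: complete 'I_n r)) ==
           #|complete 'I_n r :\: complete 'I_n r| by rewrite -cardE.
apply/existsP; exists (Tuple szK); rewrite perm_refl /=.
apply/forallP=> -[i i_lt]; exfalso; move: i_lt.
by rewrite setDv cards0.
Qed.

Lemma wsatP (V : finType) (r n : nat) (H : {set {set V}}) :
  (exists2 F : {set {set 'I_n}},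
     weakly_saturated r H F & wsat r n H = #|F|) /\
  (forall F : {set {set 'I_n}}, weakly_saturated r H F -> wsat r n H <= #|F|).
Proof.
apply: (bigminn_attained (weakly_saturated_complete r n H)) => F /andP[sF _].
have <- : #|complete 'I_n r| = 'C(n, r) by rewrite card_draws card_ord.
exact: subset_leq_card.
Qed.

Lemma gammaP (V : finType) (s : nat) (H G0 : {set {set V}}) :
  gamma_range s H G0 ->
  (exists2 G, gamma_range s H G & gamma s H = gamma_ratio s H G) /\
  (forall G, gamma_range s H G -> (gamma s H <= gamma_ratio s H G)%R).
Proof.
move=> rG0; split; last by move=> G rG; apply: bigmin_le_cond.
have [|G rG eG] := eq_bigmin (x := #|H|%:R%R) G0 (gamma_range s H)
  (gamma_ratio s H) rG0; last by exists G.
move=> G /and3P[sGH _ ltsh]; rewrite /gamma_ratio.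
have d1 : (1 <= #|shadow (s - 1) H|%:R - #|shadow (s - 1) G|%:R :> rat)%R.
  by rewrite -natrB 1?ltnW // (ler_nat _ 1) subn_gt0.
rewrite ler_pdivrMr; last exact: lt_le_trans ltr01 d1.
apply: (@le_trans _ _ (#|H|%:R : rat)%R).
  by rewrite -addrA gerDl -opprD oppr_le0 addr_ge0 ?ler0n.
by rewrite ler_peMr ?ler0n.
Qed.

Lemma gamma_range_ex (V : finType) (r : nat) (H : {set {set V}}) :
  uniform r H -> H != set0 -> 2 <= sparseness H ->
  exists G, gamma_range (sparseness H) H G.
Proof.
move=> Hr H0 s2; have [_ smin] := sparsenessP Hr H0.
have /set0Pn[e eH] := H0; set s := sparseness H in s2 smin *.
have He f : f \in H -> #|f| = r.
  by move: Hr => /forall_inP Hr fH; apply/eqP/Hr.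
have le_sr : s <= r by rewrite -(He e eH); apply/smin/(in_one_edge_edge Hr).
have [f fH nfe] : exists2 f, f \in H & f != e.
  apply/exists_inP; apply: contraLR s2; rewrite negb_exists_in -leqNgt.
  move=> /forall_inP Hall; apply: leq_trans (smin set0 _) _; last by rewrite cards0.
  apply/cards1P; exists e; apply/setP=> f; rewrite !inE sub0set andbT.
  by apply/idP/eqP => [/Hall/negPn/eqP|->].
have [v vf ve] : exists2 v, v \in f & v \notin e.
  by apply/subsetPn; apply: contra nfe => sfe; rewrite eqEcard sfe !He /=.
exists [set e]; apply/and3P; split; first by rewrite sub1set.
  by apply/set0Pn; exists e; rewrite set11.
apply/proper_card/properP; split.
  apply/subsetP=> S; rewrite !inE => /andP[-> /exists_inP[g]].
  by rewrite inE => /eqP-> Se; apply/exists_inP; exists e.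
have : s - 2 <= #|f :\ v|.
  by move: (cardsD1 v f); rewrite vf He // => E; lia.
case/card_geqP => t [ut szt st]; exists (v |: [set x in t]).
  rewrite inE cardsU1 inE cardsE (card_uniqP ut) szt; apply/andP; split.
    suff -> : v \notin t by apply/eqP; lia.
    by apply/negP=> /st; rewrite !inE eqxx.
  apply/exists_inP; exists f => //; rewrite subUset sub1set vf /=.
  by apply/subsetP=> x; rewrite inE => /st; rewrite !inE => /andP[].
apply/negP; rewrite inE => /andP[_ /exists_inP[g]]; rewrite inE => /eqP->.
by rewrite subUset sub1set (negbTE ve).
Qed.

(* Main.v *)
Require Import Defs.
From mathcomp Require Import all_boot all_order all_algebra.
From mathcomp Require Import perm.
From mathcomp Require Import zify lra.

Set Implicit Arguments.
Unset Strict Implicit.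
Unset Printing Implicit Defensive.

Import Order.TTheory GRing.Theory Num.Theory.

(** Put [c = |E(H)| - 1 - gamma |∂H|] and call a set [C] of edges of [K_n] dense
    if [|C ∩ F| >= gamma |∂C| + c]. Along the saturation process we keep a family
    of pairwise disjoint dense sets covering all edges added so far. A new copy
    [K] of [H] is merged with all the members [C] that it meets: since the shadow
    is submodular and since [|G| - gamma |∂G| <= c] for every proper non-empty
    [G = K ∩ C] (the definition of [gamma]), the merged set is dense again, the
    one new edge of [K] paying for the [-1] in [c]. Afterwards all remaining
    copies of [H] in [K_n] are merged in the same way. As [s >= 2], every vertex
    of an edge of [H] lies in a second edge, which makes the edges of [K_n]
    connected through copies of [H]; so one dense set is [K_n] itself. *)

(** * Merging dense sets under a submodular function *)

Section Merging.

Variable T : finType.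
Implicit Types (X Y C E F G K : {set T}) (P Q : {set {set T}}).

Lemma card_setI_cover X Q :
  trivIset Q -> #|X :&: cover Q| = \sum_(C in Q) #|X :&: C|.
Proof.
move=> tQ; rewrite setIC -sum1_card.
under eq_bigl do rewrite inE.
rewrite big_mkcondr (big_trivIset _ tQ) /=; apply: eq_bigr => C _.
rewrite -big_mkcondr -sum1_card; apply: eq_bigl => x.
by rewrite inE andbC.
Qed.

Local Open Scope ring_scope.

Definition supermodular (psi : {set T} -> rat) :=
  forall X Y, psi X + psi Y <= psi (X :|: Y) + psi (X :&: Y).

(** The members of [Q] are joined to [X] one at a time. As they are disjoint, a new member [C] meets
    what has been built so far only in [X :&: C], so supermodularity yields a gain of at least
    [psi C - psi (X :&: C)]. *)
Lemma supermodular_cover psi X Q : supermodular psi -> trivIset Q ->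
  psi X + \sum_(C in Q) (psi C - psi (X :&: C)) <= psi (X :|: cover Q).
Proof.
move=> supP /trivIsetP tQ; rewrite /cover -!big_enum /=.
have : {subset enum Q <= Q} by move=> C; rewrite mem_enum.
elim: (enum Q) (enum_uniq Q) => [|C s IH] /=.
  by move=> _ _; rewrite !big_nil setU0 addr0.
case/andP=> Cs us sQ; rewrite !big_cons.
have CQ : C \in Q by apply: sQ; rewrite mem_head.
have {}IH := IH us (fun D Ds => sQ D (mem_behead (s := C :: s) Ds)).
have dis : C :&: \bigcup_(D <- s) D = set0.
  apply/eqP; rewrite setI_eq0 bigcup_seq; apply: bigcup_disjoint => D Ds; apply: tQ => //.
    by apply: sQ; rewrite in_cons Ds orbT.
  by apply: contraNneq Cs => ->.
have := supP (X :|: \bigcup_(D <- s) D) C.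
rewrite setIUl [_ :&: C in X in X -> _]setIC.
rewrite [(\bigcup_(_ <- _) _) :&: C]setIC dis setU0 [C :&: X]setIC.
rewrite -setUA [_ :|: C]setUC.
by move: IH; set S := \sum_(_ <- _) _; lra.
Qed.

Variables (d : {set T} -> rat) (c : rat) (F : {set T}).
Hypothesis d_submod : forall X Y, d (X :|: Y) + d (X :&: Y) <= d X + d Y.

Definition dense C := d C + c <= #|C :&: F|%:R.

Definition merge_family P := trivIset P /\ {in P, forall C, dense C}.

(* [|K| - 1 - d K] plays the role of [c] for a copy [K] of [H]. *)
Definition critical K :=
  c = #|K|%:R - 1 - d K /\
  forall G, G \proper K -> G != set0 -> #|G|%:R - d G <= c.

Lemma supermodular_excess : supermodular (fun X => #|X :&: F|%:R - d X).
Proof.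
move=> X Y; have := d_submod X Y.
have : (#|(X :|: Y) :&: F| + #|(X :&: Y) :&: F| = #|X :&: F| + #|Y :&: F|)%N.
  by rewrite setIUl setIIl cardsUI.
move/(congr1 (fun k : nat => k%:R : rat)); rewrite !natrD; lra.
Qed.

(** By [supermodular_cover] for the excess [#|X :&: F| - d X], the union gains at least the excess
    of [C] minus that of [K :&: C] for each [C]. Density of [C] and criticality of [K] bound this
    below by the number of edges of [K :&: C] outside [F]. In total all edges of [K] except possibly
    [e] are counted, which gives [#|K| - 1 - d K = c]. *)
Lemma dense_merge Q K e : trivIset Q -> {in Q, forall C, dense C} ->
  critical K -> {in Q, forall C, C :&: K != set0} ->
  {in Q, forall C, ~~ (K \subset C)} ->
  K \subset e |: (F :|: cover Q) -> dense (K :|: cover Q).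
Proof.
move=> tQ dQ [cE cG] meet nsub sK.
have := supermodular_cover K supermodular_excess tQ; rewrite /dense.
set S := \sum_(_ in _) _.
suff : c <= #|K :&: F|%:R - d K + S by lra.
have SE : \sum_(C in Q) (#|K :&: C|%:R - #|(K :&: C) :&: F|%:R) <= S.
  apply: ler_sum => C CQ.
  have -> : #|K :&: C|%:R - #|(K :&: C) :&: F|%:R =
      (#|K :&: C|%:R - d (K :&: C)) + (d (K :&: C) - #|(K :&: C) :&: F|%:R) :> rat.
    by lra.
  have pr : K :&: C \proper K.
    by rewrite properE subsetIl subsetI subxx /= nsub.
  have nz : K :&: C != set0 by rewrite setIC meet.
  have := cG _ pr nz; have := dQ _ CQ; rewrite /dense; lra.
apply: le_trans (lerD (lexx _) SE); rewrite big_split /= sumrN -!natr_sum.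
rewrite -(card_setI_cover K tQ).
under eq_bigr do rewrite setIAC.
rewrite -(card_setI_cover (K :&: F) tQ) cE.
have E1 := cardsID (cover Q) K; have E2 := cardsID (cover Q) (K :&: F).
(* Off [cover Q], only [e] can be an edge of [K] outside [F]. *)
have le1 : (#|K :\: cover Q| <= #|(K :&: F) :\: cover Q| + 1)%N.
  rewrite -(cards1 e); apply: leq_trans (leq_card_setU _ _).
  apply: subset_leq_card; apply/subsetP => x; rewrite !inE => /andP[xQ xK].
  by have := subsetP sK x xK; rewrite !inE xK (negbTE xQ) orbF orbC.
have : (#|K| + #|K :&: F :&: cover Q| <=
        #|K :&: F| + #|K :&: cover Q| + 1)%N by lia.
rewrite -(ler_nat rat) !natrD; lra.
Qed.

(** If a member already contains [K], the family stays as it is; otherwise [K] and the members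
    meeting it become one member. The last clause says that members only grow, so copies covered
    earlier stay covered. *)
Lemma merge_step P K e E : merge_family P -> E \subset F :|: cover P ->
  critical K -> e \in K -> K \subset e |: E ->
  exists P', [/\ merge_family P', e |: E \subset F :|: cover P',
    exists2 C, C \in P' & K \subset C &
    {in P, forall C, exists2 C', C' \in P' & C \subset C'}].
Proof.
move=> [tP dP] sE cK eK sK.
have coverE P' : {in P, forall C, exists2 C', C' \in P' & C \subset C'} ->
    (exists2 C, C \in P' & K \subset C) -> e |: E \subset F :|: cover P'.
  move=> sP [C CP' KC]; apply/subsetP => x; rewrite in_setU1 in_setU.
  case/predU1P => [->|/(subsetP sE)].
    by apply/orP; right; apply/bigcupP; exists C => //; apply: (subsetP KC).
  rewrite in_setU => /orP[-> //|/bigcupP[D DP xD]].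
  have [D' D'P' DD'] := sP D DP; apply/orP; right.
  by apply/bigcupP; exists D' => //; apply: (subsetP DD').
have [/exists_inP[C CP KC]|] := boolP [exists C in P, K \subset C].
  have KP : exists2 C, C \in P & K \subset C by exists C.
  have PP : {in P, forall C, exists2 C', C' \in P & C \subset C'}.
    by move=> D DP; exists D.
  by exists P; split => //; apply: coverE.
rewrite negb_exists_in => /forall_inP nsub.
(* Meeting [K] makes [K :&: C] non-empty, as [critical] demands; the other members stay disjoint
   from the merged set. *)
pose Q := [set C in P | C :&: K != set0].
have QP : Q \subset P by apply/subsetP => C; rewrite inE => /andP[].
have tQ : trivIset Q by apply: trivIsetS tP.
pose A := K :|: cover Q.
have dA : dense A.
  apply: (@dense_merge Q K e) => //.
  - by move=> C /(subsetP QP)/dP.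
  - by move=> C; rewrite inE => /andP[].
  - by move=> C /(subsetP QP)/nsub.
  apply/subsetP => x xK; have := subsetP sK x xK; rewrite !inE.
  case/orP=> [-> //|/(subsetP sE)]; rewrite in_setU.
  case/orP=> [->|/bigcupP[C CP xC]]; first by rewrite orbT.
  suff -> : x \in cover Q by rewrite !orbT.
  apply/bigcupP; exists C => //; rewrite inE CP.
  by apply/set0Pn; exists x; rewrite inE xC.
have sP : {in P, forall C, exists2 C', C' \in A |: (P :\: Q) & C \subset C'}.
  move=> C CP; have [CQ|CQ] := boolP (C \in Q).
    exists A; rewrite ?setU11 // subsetU // orbC.
    by rewrite (bigcup_sup C).
  by exists C => //; rewrite in_setU1 in_setD CQ CP orbT.
have KA : exists2 C, C \in A |: (P :\: Q) & K \subset C.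
  by exists A; rewrite ?setU11 // subsetUl.
exists (A |: (P :\: Q)); split => //; last exact: coverE.
split; last first.
  by move=> C; rewrite in_setU1 => /predU1P[-> //|]; rewrite in_setD => /andP[_ /dP].
have disA C : C \in P :\: Q -> [disjoint A & C].
  rewrite in_setD => /andP[CQ CP].
  rewrite -setI_eq0 setIUl setU_eq0; apply/andP; split.
    by apply: contraR CQ; rewrite inE CP setIC.
  rewrite setI_eq0 disjoint_sym; apply: bigcup_disjoint => D DQ.
  rewrite disjoint_sym; apply: (trivIsetP tP) => //; first exact: (subsetP QP).
  by apply: contraNneq CQ => <-.
apply/trivIsetP => B C; rewrite !in_setU1.
case/predU1P => [->|BP] /predU1P[->|CP] nBC.
- by rewrite eqxx in nBC.
- exact: disA.
- by rewrite disjoint_sym; apply: disA.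
- by move: BP CP; rewrite !in_setD => /andP[_ BP] /andP[_ CP]; apply: (trivIsetP tP).
Qed.

(** Every [K] lies inside [E], so [merge_step] applies with any edge of [K] in the role of the new
    edge and leaves [E] unchanged. *)
Lemma merge_all (Ks : seq {set T}) P E :
  merge_family P -> E \subset F :|: cover P ->
  {in Ks, forall K, [/\ critical K, K != set0 & K \subset E]} ->
  exists P', [/\ merge_family P', E \subset F :|: cover P' &
    {in Ks, forall K, exists2 C, C \in P' & K \subset C}].
Proof.
move=> mP sP; elim: Ks => [|K Ks IH] hK; first by exists P.
have [|P1 [mP1 sP1 hP1]] := IH.
  by move=> L LKs; apply: hK; rewrite in_cons LKs orbT.
have [cK /set0Pn[e eK] KE] := hK K (mem_head _ _).
have eE : e |: E = E by apply/setUidPr; rewrite sub1set (subsetP KE).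
have := merge_step mP1 sP1 cK eK; rewrite eE => /(_ KE)[P2 [mP2 sP2 KP2 P12]].
exists P2; split => // L; rewrite in_cons => /predU1P[-> //|/hP1[C CP1 LC]].
by have [C' C'P2 CC'] := P12 C CP1; exists C' => //; apply: subset_trans CC'.
Qed.

End Merging.

(** * Shadows: submodularity, copies, complete hypergraphs *)

Section Shadow.

Variables (V W : finType) (m : nat).

Lemma shadowS (X Y : {set {set V}}) :
  X \subset Y -> shadow m X \subset shadow m Y.
Proof.
move=> sXY; apply/subsetP => S; rewrite !inE => /andP[-> /exists_inP[e eX Se]].
by apply/exists_inP; exists e => //; apply: (subsetP sXY).
Qed.

Lemma shadowU (X Y : {set {set V}}) :
  shadow m (X :|: Y) = shadow m X :|: shadow m Y.
Proof.
apply/eqP; rewrite eqEsubset subUset !shadowS ?subsetUl ?subsetUr // !andbT.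
apply/subsetP => S; rewrite !inE => /andP[-> /exists_inP[e]]; rewrite inE.
by case/orP=> eX Se; apply/orP; [left|right]; apply/exists_inP; exists e.
Qed.

(** The shadow commutes with unions, while the shadow of [X :&: Y] is only contained in the
    intersection of the shadows. *)
Lemma shadow_submod (X Y : {set {set V}}) :
  #|shadow m (X :|: Y)| + #|shadow m (X :&: Y)| <= #|shadow m X| + #|shadow m Y|.
Proof.
rewrite shadowU -[leqRHS]cardsUI leq_add2l; apply: subset_leq_card.
by rewrite subsetI !shadowS ?subsetIl ?subsetIr.
Qed.

Lemma card_copy (f : {ffun V -> W}) (G : {set {set V}}) :
  injective f -> #|copy f G| = #|G|.
Proof. by move=> f_inj; rewrite card_imset //; apply: imset_inj. Qed.

Lemma shadow_copy (f : {ffun V -> W}) (G : {set {set V}}) :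
  injective f -> shadow m (copy f G) = copy f (shadow m G).
Proof.
move=> f_inj; apply/setP => S; apply/idP/imsetP.
  rewrite inE => /andP[/eqP cS /exists_inP[_ /imsetP[e eG ->] Se]].
  have SE : S = f @: (f @^-1: S).
    apply/setP => y; apply/idP/imsetP => [yS|[x]]; last by rewrite inE => ? ->.
    by have /imsetP[x _ yE] := subsetP Se y yS; exists x; rewrite // inE -yE.
  exists (f @^-1: S) => //; rewrite inE -(card_imset _ f_inj) -SE cS eqxx.
  apply/exists_inP; exists e => //; apply/subsetP => x; rewrite inE.
  by move/(subsetP Se); rewrite mem_imset.
case=> S'; rewrite inE => /andP[/eqP cS' /exists_inP[e eG S'e]] ->.
rewrite inE card_imset // cS' eqxx; apply/exists_inP.
by exists (f @: e); [apply: imset_f|apply: imsetS].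
Qed.

(** This pulls a part of a copy back to a part of [H], where [gamma] gives information. *)
Lemma copyS_preim (f : {ffun V -> W}) (H : {set {set V}}) (G : {set {set W}}) :
  G \subset copy f H -> G = copy f [set e in H | f @: (e : {set V}) \in G].
Proof.
move=> sG; apply/setP => S; apply/idP/imsetP => [SG|[e]]; last first.
  by rewrite inE => /andP[_ eG] ->.
by have /imsetP[e eH SE] := subsetP sG S SG; exists e; rewrite // inE eH -SE.
Qed.

Lemma card_shadow_complete r :
  m <= r <= #|V| -> #|shadow m (complete V r)| = 'C(#|V|, m).
Proof.
move=> /andP[mr rV]; rewrite -card_draws; apply: eq_card => S; rewrite !inE.
have [/eqP cS|//] := boolP (#|S| == m); apply/exists_inP.
have : r - m <= #|~: S| by have := cardsC S; lia.
case/card_geqP => t [ut szt st]; exists (S :|: [set x in t]); last exact: subsetUl.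
rewrite inE cardsU (_ : S :&: _ = set0) ?cards0.
  by rewrite cardsE (card_uniqP ut) szt; apply/eqP; lia.
by apply/setP => x; rewrite !inE; apply/andP => -[xS /st]; rewrite inE xS.
Qed.

End Shadow.

(** * Connectivity of the complete hypergraph through copies of [H] *)

Section Connectivity.

Variables (V W : finType) (r : nat) (H : {set {set V}}) (C : {set {set W}}).
Hypothesis H_uniform : uniform r H.
Hypothesis H_second_edge : forall e z,
  e \in H -> z \in e -> exists f, [/\ f \in H, f != e & z \in f].
Hypothesis C_closed : forall g : {ffun V -> W}, injective g ->
  {in H &, forall e f : {set V}, g @: e \in C -> g @: f \in C}.

Lemma tperm_imset_id (u v : W) (A : {set W}) :
  (u \in A) = (v \in A) -> tperm u v @: A = A.
Proof.
move=> uv; apply/eqP; rewrite eqEcard (card_imset _ perm_inj) leqnn andbT.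
apply/subsetP => _ /imsetP[x xA ->].
by case: tpermP => [xu|xv|//]; [rewrite -uv -xu|rewrite uv -xv].
Qed.

Lemma tperm_comp_inj (u v : W) (g : {ffun V -> W}) :
  injective g -> injective (finfun (tperm u v \o g)).
Proof. by move=> g_inj x y; rewrite !ffunE /= => /perm_inj/g_inj. Qed.

Lemma imset_tperm_comp (u v : W) (g : {ffun V -> W}) (e : {set V}) :
  finfun (tperm u v \o g) @: e = tperm u v @: (g @: e).
Proof. by rewrite -imset_comp; apply: eq_imset => x; rewrite ffunE. Qed.

(* A second edge [f] through [g^-1 u] is used as a bridge: after moving [v] into
   [g f], the transposition fixes [g f] but moves [g e]. *)
Lemma closed_tperm (g : {ffun V -> W}) (e : {set V}) (u v : W) :
  injective g -> e \in H -> g @: e \in C -> u \in g @: e -> v \notin g @: e ->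
  tperm u v @: (g @: e) \in C.
Proof.
move=> g_inj eH eC /imsetP[z ze ->] ve.
have [f [fH nfe zf]] := H_second_edge eH ze.
have [y yf ye] : exists2 y, y \in f & y \notin e.
  apply/subsetPn; apply: contra nfe => sfe.
  have /forall_inP Hr := H_uniform.
  by rewrite eqEcard sfe (eqP (Hr _ eH)) (eqP (Hr _ fH)) /=.
pose g' := finfun (tperm v (g y) \o g).
have g'_inj : injective g' by apply: tperm_comp_inj.
have g'e : g' @: e = g @: e.
  rewrite imset_tperm_comp tperm_imset_id // (negbTE ve).
  by rewrite mem_imset // (negbTE ye).
have g'z : g' z = g z.
  rewrite ffunE /= tpermD //; first by apply: contraNneq ve => ->; apply: imset_f.
  by apply: contraNneq ye => /g_inj ->.
have g'y : g' y = v by rewrite ffunE /= tpermR.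
have gfC : g' @: f \in C by apply: (C_closed g'_inj eH fH); rewrite g'e.
pose h := finfun (tperm (g z) v \o g').
have h_inj : injective h by apply: tperm_comp_inj.
rewrite -g'e -imset_tperm_comp; apply: (C_closed h_inj fH eH).
rewrite imset_tperm_comp tperm_imset_id // -g'z -g'y.
by rewrite !imset_f.
Qed.

(** The edge [g @: e] is moved to an arbitrary [B] of the same size by transpositions, each
    exchanging a vertex outside [B] for one of [B]. [closed_tperm] keeps the edge in [C], and
    [g @: e :\: B] shrinks each time. *)
Lemma closed_complete (g : {ffun V -> W}) (e : {set V}) :
  injective g -> e \in H -> g @: e \in C -> complete W r \subset C.
Proof.
move=> g_inj eH eC; apply/subsetP => B; rewrite inE => /eqP cB.
have ce : #|e| = r by have /forall_inP Hr := H_uniform; apply/eqP/Hr.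
move: {2}(#|_ :\: _|) (leqnn #|g @: e :\: B|) => k.
elim: k g g_inj eC => [|k IH] g g_inj eC le_k.
  have sB : g @: e \subset B by rewrite -setD_eq0 -cards_eq0 -leqn0.
  suff <- : g @: e = B by [].
  by apply/eqP; rewrite eqEcard sB card_imset // ce cB /=.
have [sB|/subsetPn[u ue uB]] := boolP (g @: e \subset B).
  apply: (IH g) => //; move: sB; rewrite -setD_eq0 => /eqP ->.
  by rewrite cards0.
have [v vB ve] : exists2 v, v \in B & v \notin g @: e.
  apply/subsetPn; apply: contra uB => sB.
  suff -> : B = g @: e by [].
  by apply/eqP; rewrite eqEcard sB card_imset // ce cB /=.
apply: (IH (finfun (tperm u v \o g))); first exact: tperm_comp_inj.
  by rewrite imset_tperm_comp; apply: closed_tperm.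
rewrite imset_tperm_comp -ltnS; apply: leq_trans le_k.
apply/proper_card/properP; split; last first.
  exists u; rewrite inE uB //=; apply/imsetP => -[x xe /esym xu].
  by move: xe; rewrite -[x](tpermK u v) xu tpermL (negbTE ve).
apply/subsetP => w; rewrite inE => /andP[wB /imsetP[x xe wE]].
rewrite inE wB wE /=; move: wB; rewrite wE.
by case: tpermP => // _; rewrite vB.
Qed.

End Connectivity.

(** * Consequences of the sparseness *)

Lemma second_edge (V : finType) (r : nat) (H : {set {set V}}) (e : {set V}) (z : V) :
  uniform r H -> 2 <= sparseness H -> e \in H -> z \in e ->
  exists f, [/\ f \in H, f != e & z \in f].
Proof.
move=> Hr s2 eH ze.
have [|_ smin] := sparsenessP Hr; first by apply/set0Pn; exists e.
(* A singleton is smaller than the sparseness, so it cannot lie in exactly one edge; as it lies in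
   [e], another edge contains it. *)
have n1 : ~~ in_one_edge H [set z].
  by apply/negP => /smin; rewrite cards1; lia.
have eS : e \in [set f in H | [set z] \subset f] by rewrite inE eH sub1set.
have : 0 < #|[set f in H | [set z] \subset f] :\ e|.
  rewrite lt0n; apply: contra n1 => /eqP E.
  by rewrite /in_one_edge (cardsD1 e) eS E.
by case/card_gt0P => f; rewrite !inE sub1set => /and3P[? ? ?]; exists f.
Qed.

Lemma sparseness_le (V : finType) (r : nat) (H : {set {set V}}) :
  uniform r H -> H != set0 -> sparseness H <= r.
Proof.
move=> Hr H0; have [_ smin] := sparsenessP Hr H0.
have /set0Pn[e eH] := H0; have /forall_inP Hc := Hr.
by rewrite -(eqP (Hc e eH)); apply/smin/(in_one_edge_edge Hr).
Qed.

(** * The constant [gamma] and criticality of copies *)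

Section Gamma.

Local Open Scope ring_scope.

Variables (V : finType) (s : nat) (H G0 : {set {set V}}).
Hypothesis G0_range : gamma_range s H G0.

(** A strictly smaller shadow forces [G] to miss an edge of [H], so the numerator [#|H| - #|G| - 1]
    is non-negative. *)
Lemma gamma_ge0 : 0 <= gamma s H.
Proof.
have [[G /and3P[sGH _ ltsh] ->] _] := gammaP G0_range.
have ltGH : (#|G| < #|H|)%N.
  apply/proper_card; rewrite properEneq sGH andbT.
  by apply: contraTneq ltsh => ->; rewrite ltnn.
apply: divr_ge0; last by rewrite subr_ge0 ler_nat ltnW.
by rewrite -addrA -opprD subr_ge0 natr1 ler_nat.
Qed.

(** If the shadow of [G] is smaller, this is [gamma <= gamma_ratio] with the denominator cleared. If
    the shadows have equal size, the [gamma] terms agree and [#|G| + 1 <= #|H|] suffices. *)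
Lemma gamma_le (G : {set {set V}}) : G \proper H -> G != set0 ->
  #|G|%:R - gamma s H * #|shadow (s - 1) G|%:R <=
  #|H|%:R - 1 - gamma s H * #|shadow (s - 1) H|%:R.
Proof.
move=> pGH G0'; have [_ gmin] := gammaP G0_range.
have sGH := proper_sub pGH.
have leGH : #|G|%:R + 1 <= #|H|%:R :> rat by rewrite natr1 ler_nat proper_card.
have := subset_leq_card (shadowS (s - 1) sGH); rewrite leq_eqVlt.
case/predU1P => [->|ltsh]; first by rewrite lerD2r; lra.
have := gmin G; rewrite /gamma_range sGH G0' ltsh => /(_ isT).
rewrite /gamma_ratio ler_pdivlMr ?subr_gt0 ?ltr_nat // mulrBr; lra.
Qed.

Lemma critical_copy (W : finType) (f : {ffun V -> W}) : injective f ->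
  critical (fun X => gamma s H * #|shadow (s - 1) X|%:R)
    (#|H|%:R - 1 - gamma s H * #|shadow (s - 1) H|%:R) (copy f H).
Proof.
move=> f_inj; split; first by rewrite shadow_copy // !card_copy.
move=> G pG G0'; have GE := copyS_preim (proper_sub pG).
move: GE pG G0'; set X := [set e in H | _] => -> pX X0.
rewrite shadow_copy // !card_copy //; apply: gamma_le.
  rewrite properEcard; apply/andP; split.
    by apply/subsetP => e; rewrite inE => /andP[].
  by have := proper_card pX; rewrite !card_copy.
by apply: contraNneq X0 => ->; rewrite /copy imset0.
Qed.

End Gamma.

(** * The lower bound, from the saturation process of a minimum [F] *)

Theorem theorem5p2 (r s : nat) (hr : (2 <= r)%N) (hs : (2 <= s)%N)
    (V : finType) (H : {set {set V}}) (H_uniform : uniform r H)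
    (H_nonempty : H != set0) (H_sparseness : sparseness H = s)
    (n : nat) (hn : (#|V| <= n)%N) :
  ((wsat r n H)%:R >=
     gamma s H * ('C(n, (s - 1)%N)%:R - #|shadow (s - 1)%N H|%:R)
     + #|H|%:R - 1 :> rat)%R.
Proof.
have [[F /andP[_ /existsP[es /andP[es_perm /forallP es_copy]]] ->] _] := wsatP r n H.
have s2 : 2 <= sparseness H by rewrite H_sparseness.
have [G0 G0_range] := gamma_range_ex H_uniform H_nonempty s2.
rewrite H_sparseness in G0_range.
pose d (X : {set {set 'I_n}}) := (gamma s H * #|shadow (s - 1) X|%:R)%R.
pose c := (#|H|%:R - 1 - gamma s H * #|shadow (s - 1) H|%:R)%R.
have d_submod X Y : (d (X :|: Y) + d (X :&: Y) <= d X + d Y)%R.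
  rewrite -!mulrDr -!natrD ler_wpM2l ?(gamma_ge0 G0_range) // ler_nat.
  exact: shadow_submod.
have [e0 e0H] := set0Pn _ H_nonempty.
have He e : e \in H -> #|e| = r.
  by have /forall_inP Hr := H_uniform => eH; apply/eqP/Hr.
have copy_complete (g : {ffun V -> 'I_n}) : injective g -> copy g H \subset complete 'I_n r.
  move=> g_inj; apply/subsetP => _ /imsetP[e eH ->].
  by rewrite inE card_imset // He.
have [P [mP sP]] : exists P, merge_family d c F P /\
    F :|: [set e in take (size es) es] \subset F :|: cover P.
  (* Induction on the number of edges added, starting from the empty family. *)
  elim: {-2}(size es) (leqnn (size es)) => [_|i IH lt_i].
    exists set0; split; last first.
      by apply/subsetP => x; rewrite take0 !inE orbF => ->.
    by split=> [|C]; [apply/trivIsetP => ? ?|]; rewrite inE.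
  have [P [mP sP]] := IH (ltnW lt_i).
  have i_lt : i < #|complete 'I_n r :\: F| by rewrite -(size_tuple es).
  have /existsP[g /and3P[/injectiveP g_inj gK eg]] := es_copy (Ordinal i_lt).
  have takeE : F :|: [set e in take i.+1 es] =
      tnth es (Ordinal i_lt) |: (F :|: [set e in take i es]).
    apply/setP => x; rewrite !inE (take_nth x) // mem_rcons in_cons.
    by rewrite (tnth_nth x) orbCA.
  rewrite takeE in gK *.
  have [P' [mP' sP' _ _]] :=
    merge_step d_submod mP sP (critical_copy G0_range g_inj) eg gK.
  by exists P'.
have {}sP : complete 'I_n r \subset F :|: cover P.
  apply: subset_trans sP; apply/subsetP => e er; rewrite take_size !inE.
  by rewrite (perm_mem es_perm) mem_enum in_setD er andbT orbN.
(* All edges are now present, so every copy of [H] can be merged, not only those met during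
   saturation. *)
pose Ks := [seq copy g H | g : {ffun V -> 'I_n} <- enum {ffun V -> 'I_n}
                         & injectiveb g].
have KsP (g : {ffun V -> 'I_n}) : injective g -> copy g H \in Ks.
  by move=> /injectiveP g_inj; apply: map_f; rewrite mem_filter g_inj mem_enum.
have [|Q [[tQ dQ] _ QP]] := merge_all (Ks := Ks) d_submod mP sP.
  move=> K /mapP[g]; rewrite mem_filter => /andP[/injectiveP g_inj _] ->.
  split; [exact: (critical_copy G0_range)| |exact: copy_complete].
  by apply/set0Pn; exists (g @: e0); apply: imset_f.
pose g0 := [ffun x : V => widen_ord hn (enum_rank x)].
have g0_inj : injective g0.
  move=> x y; rewrite !ffunE => /(congr1 val) /= xy.
  by apply/enum_rank_inj/val_inj.
have [C CQ g0C] := QP _ (KsP _ g0_inj).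
have CE : complete 'I_n r \subset C.
  apply: (closed_complete H_uniform _ _ g0_inj e0H).
  - by move=> e z; apply: second_edge H_uniform s2.
  - move=> g g_inj e f eH fH eC; have [D DQ gD] := QP _ (KsP _ g_inj).
    have eD : g @: e \in D by apply: (subsetP gD); apply: imset_f.
    (* Two members of a disjoint family sharing the edge [g @: e] coincide; hence [C] is closed
       under passing between edges of one copy. *)
    have <- : D = C.
      by apply: contraTeq eC => nDC; rewrite (disjointFr (trivIsetP tQ D C DQ CQ nDC) eD).
    by apply: (subsetP gD); apply: imset_f.
  - by apply: (subsetP g0C); apply: imset_f.
have rn : r <= #|'I_n| by rewrite card_ord -(He e0 e0H) (leq_trans (max_card _)).
have sr : s - 1 <= r.
  by rewrite -H_sparseness (leq_trans (leq_subr _ _)) // (sparseness_le H_uniform).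
(* As [s - 1 <= r <= n], every set of size [s - 1] extends to an edge of the complete hypergraph,
   hence of [C]. Density of [C] then gives the bound, as [#|C :&: F| <= #|F|]. *)
have shC : 'C(n, s - 1) <= #|shadow (s - 1) C|.
  rewrite -{1}(card_ord n) -(card_shadow_complete (r := r)) ?sr //.
  exact/subset_leq_card/shadowS.
have := dQ C CQ; rewrite /dense /d /c.
have : (#|C :&: F|%:R <= #|F|%:R :> rat)%R by rewrite ler_nat subset_leq_card ?subsetIr.
have : (gamma s H * 'C(n, s - 1)%:R <= gamma s H * #|shadow (s - 1) C|%:R)%R.
  by rewrite ler_wpM2l ?(gamma_ge0 G0_range) // ler_nat.
rewrite mulrBr; lra.
Qed.
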